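(* Let $\Omega$ be any open set in $\mathbb{R}^n$ with $\Omega\ne\mathbb{R}^n$, and let $0<s<1$, $p>1$ be such that $sp>n$. Then there exists a constant $C=C(n,s,p)>0$ such that the fractional Hardy inequality $$\int_{\Omega}\frac{|u(x)|^p}{\delta(x)^{sp}}\,dx\le C\int_{\mathbb{R}^n}\int_{\mathbb{R}^n}\frac{|u(x)-u(y)|^p}{|x-y|^{n+sp}}\,dx\,dy\qquad\text{for all }u\in W^{s,p}_{\Omega}(\mathbb{R}^n)$$ holds. Furthermore, the regional fractional Hardy inequality $$\int_{\Omega}\frac{|u(x)|^p}{\delta(x)^{sp}}\,dx\le C\int_{\Omega}\int_{\Omega}\frac{|u(x)-u(y)|^p}{|x-y|^{n+sp}}\,dx\,dy\qquad\text{for all }u\in W^{s,p}_{0}(\Omega)$$ holds (with a constant $C=C(n,s,p)>0$).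
   Context: $\delta(x)=\mathrm{dist}(x,\partial\Omega)$. For an open set $U\subseteq\mathbb{R}^n$, $[u]_{s,p,U}^p=\int_U\int_U\frac{|u(x)-u(y)|^p}{|x-y|^{n+sp}}\,dx\,dy$ and $\|u\|_{s,p,U}=(\|u\|_{L^p(U)}^p+[u]_{s,p,U}^p)^{1/p}$. $W^{s,p}_0(\Omega)$ is the closure of $C_c^\infty(\Omega)$ with respect to $\|\cdot\|_{s,p,\Omega}$, and $W^{s,p}_{\Omega}(\mathbb{R}^n)$ is the closure of $C_c^\infty(\Omega)$ (functions extended by zero to $\mathbb{R}^n$) with respect to $\|\cdot\|_{s,p,\mathbb{R}^n}$. *)

(* Defs.v *)
From HB Require Import structures.
From mathcomp Require Import all_boot all_order all_algebra.
From mathcomp Require Import all_classical all_reals all_analysis.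
From mathcomp Require Import measurable_realfun.

Set Implicit Arguments.
Unset Strict Implicit.
Unset Printing Implicit Defensive.
Import Order.TTheory GRing.Theory Num.Theory.
Import numFieldNormedType.Exports.

Local Open Scope classical_set_scope.
Local Open Scope ring_scope.

(* The product sigma-algebra on R^n; it contains the open sets by
   [open_measurable_rV], hence it is the Borel sigma-algebra. *)
Section measurable_rV.
Context {R : realType} (n : nat).

Definition rV_coord (i : 'I_n) (x : 'rV[R]_n) : R := x ord0 i.

Let rV0 : g_sigma_preimage rV_coord set0.
Proof. exact: sigma_algebra0. Qed.

Let rVC A : g_sigma_preimage rV_coord A -> g_sigma_preimage rV_coord (~` A).
Proof. exact: sigma_algebraC. Qed.

Let rVU (F : (set 'rV[R]_n)^nat) : (forall i, g_sigma_preimage rV_coord (F i)) ->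
  g_sigma_preimage rV_coord (\bigcup_i (F i)).
Proof. exact: sigma_algebra_bigcup. Qed.

HB.instance Definition _ := @isMeasurable.Build default_measure_display
  'rV[R]_n (g_sigma_preimage rV_coord) rV0 rVC rVU.

End measurable_rV.

Lemma measurable_coord {R : realType} n (i : 'I_n) :
  measurable_fun [set: 'rV[R]_n] (fun x : 'rV[R]_n => x ord0 i).
Proof.
move=> _ Y mY; rewrite setTI; apply: sub_sigma_algebra => /=.
rewrite -bigcup_seq/=; exists i => /=; first by rewrite mem_index_enum.
by exists Y => //; rewrite setTI.
Qed.

Lemma measurable_fun_rV d (T : measurableType d) {R : realType} n
    (f : T -> 'rV[R]_n) :
  (forall i, measurable_fun [set: T] (fun t => f t ord0 i)) ->
  measurable_fun [set: T] f.
Proof.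
move=> mf _ A mA; rewrite setTI.
pose P := [set B : set 'rV[R]_n | measurable (f @^-1` B)].
suff : g_sigma_preimage (@rV_coord R n) `<=` P by apply.
apply: smallest_sub.
- split.
  + by rewrite /P /= preimage_set0.
  + by move=> B PB; rewrite /P /= setTD preimage_setC; exact: measurableC.
  + by move=> F PF; rewrite /P /= preimage_bigcup; exact: bigcupT_measurable.
- rewrite -bigcup_seq => B [i _ [C mC <-]].
  rewrite /P /= setTI; have := mf i measurableT _ mC; rewrite setTI; exact.
Qed.

Lemma open_measurable_rV {R : realType} n (U : set 'rV[R]_n) :
  open U -> measurable U.
Proof.
move=> oU.
pose c (q : 'rV[rat]_n) : 'rV[R]_n := map_mx ratr q.
pose r (k : nat) : R := k.+1%:R^-1.
have mB (x : 'rV[R]_n) e : 0 < e -> measurable (ball x e).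
  move=> e0; rewrite (_ : ball x e = \bigcap_(i in [set: 'I_n])
      (fun y : 'rV[R]_n => y ord0 i) @^-1` ball (x ord0 i) e).
    apply: fin_bigcap_measurable => // i _; rewrite -[X in measurable X]setTI.
    by apply: measurable_coord => //; apply: open_measurable; exact: ball_open.
  apply/seteqP; split => y /=; first by move=> [_ xy] i _; exact: xy.
  by move=> xy; split => // i j; rewrite (ord1 i); exact: xy.
pose S := [set qk : 'rV[rat]_n * nat | ball (c qk.1) (r qk.2) `<=` U].
rewrite (_ : U = \bigcup_(qk in S) ball (c qk.1) (r qk.2)); last first.
  apply/seteqP; split; last by move=> x [qk Sqk] /Sqk.
  move=> x Ux; have /nbhs_ballP[e /= e0 xeU] := open_nbhs_nbhs (conj oU Ux).
  have [k rk] : exists k, r k < e / 2.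
    have e20 : 0 < e / 2 by rewrite divr_gt0.
    have [k _ /(_ k)/(_ (leqnn k))] := near_infty_natSinv_lt (PosNum e20).
    by move=> /= rk; exists k.
  have r0 : 0 < r k by rewrite invr_gt0.
  have /(_ _)/cid-/all_sig[q qP] (i : 'I_n) :
      exists q : rat, `|x ord0 i - ratr q| < r k.
    have : x ord0 i - r k < x ord0 i + r k.
      by rewrite ltrBlDr -addrA ltrDl addr_gt0.
    move=> /rat_in_itvoo[q]; rewrite in_itv/= => /andP[q1 q2].
    by exists q; rewrite ltr_distlC; apply/andP; split.
  have xc : ball (c (\row_i q i)) (r k) x.
    by split => // i j; rewrite (ord1 i) !mxE /ball/= distrC; exact: qP.
  exists (\row_i q i, k) => //= y cy; apply: xeU => /=.
  apply: (@le_ball _ _ _ (r k + r k)).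
    by rewrite (splitr e) lerD// ltW.
  apply: (@ball_triangle _ _ (c (\row_i q i))) => //; exact: ball_sym.
rewrite bigcup_mkcond; apply: countable_bigcupT_measurable => [|qk].
  exact: countableP.
by case: ifP => // _; apply: mB; rewrite invr_gt0.
Qed.

Definition rV_cons {R : realType} n (xv : R * 'rV[R]_n) : 'rV[R]_n.+1 :=
  \row_i (if unlift ord0 i is Some j then xv.2 ord0 j else xv.1).

Definition rV_uncons {R : realType} n (x : 'rV[R]_n.+1) : R * 'rV[R]_n :=
  (x ord0 ord0, \row_j x ord0 (lift ord0 j)).

Lemma rV_consK {R : realType} n : cancel (@rV_cons R n) (@rV_uncons R n).
Proof.
move=> [x v]; rewrite /rV_uncons /rV_cons mxE unlift_none /=; congr pair.
by apply/rowP => j; rewrite !mxE liftK.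
Qed.

Lemma measurable_rV_cons {R : realType} n :
  measurable_fun [set: R * 'rV[R]_n] (@rV_cons R n).
Proof.
apply: measurable_fun_rV => i; rewrite /rV_cons.
case: (unliftP ord0 i) => [j ->|->].
- under eq_fun do rewrite mxE liftK.
  have /measurableT_comp := @measurable_coord R n j; apply.
  exact: (@measurable_snd _ _ R 'rV[R]_n).
- under eq_fun do rewrite mxE unlift_none.
  exact: (@measurable_fst _ _ R 'rV[R]_n).
Qed.

Lemma measurable_rV_uncons {R : realType} n :
  measurable_fun [set: 'rV[R]_n.+1] (@rV_uncons R n).
Proof.
apply: measurable_fun_pair; first exact: measurable_coord.
apply: measurable_fun_rV => i; under eq_fun do rewrite mxE.
exact: measurable_coord.
Qed.

(* Lebesgue measure on R^n, as the n-fold product of the one on R. *)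
Section lebesgue_rVS.
Local Open Scope ereal_scope.
Context {R : realType} (n : nat) (m : {sigma_finite_measure set 'rV[R]_n -> \bar R}).

Definition lebesgue_rVS : set 'rV[R]_n.+1 -> \bar R :=
  pushforward (@lebesgue_measure R \x m) (@rV_cons R n).

Let mcons := @measurable_rV_cons R n.

Let lebesgue_rVS0 : lebesgue_rVS set0 = 0.
Proof. exact: measure0. Qed.

Let lebesgue_rVS_ge0 A : 0 <= lebesgue_rVS A.
Proof. exact: measure_ge0. Qed.

Let lebesgue_rVS_sigma_additive : semi_sigma_additive lebesgue_rVS.
Proof. exact: measure_semi_sigma_additive. Qed.

HB.instance Definition _ := isMeasure.Build _ _ _ lebesgue_rVS
  lebesgue_rVS0 lebesgue_rVS_ge0 lebesgue_rVS_sigma_additive.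

Let lebesgue_rVS_sigma_finite : sigma_finite setT lebesgue_rVS.
Proof.
have /sigma_finiteP[F [FT ndF Foo]] := sigma_finiteT (@lebesgue_measure R).
have /sigma_finiteP[G [GT ndG Goo]] := sigma_finiteT m.
exists (fun k => @rV_uncons R n @^-1` (F k `*` G k)).
  rewrite -preimage_bigcup (_ : \bigcup_k _ = setT) ?preimage_setT//.
  apply/seteqP; split => // -[x v] _.
  have [i _ Fx] : (\bigcup_i F i) x by rewrite -FT.
  have [j _ Gv] : (\bigcup_j G j) v by rewrite -GT.
  exists (maxn i j) => //; split => /=.
    by move: x Fx; exact/subsetPset/ndF/leq_maxl.
  by move: v Gv; exact/subsetPset/ndG/leq_maxr.
move=> k; have [mF Fk] := Foo k; have [mG Gk] := Goo k.
have mFG : measurable (F k `*` G k) by exact: measurableX.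
split; first by rewrite -[X in measurable X]setTI; exact: measurable_rV_uncons.
rewrite /lebesgue_rVS /pushforward -comp_preimage.
rewrite (_ : _ \o _ = id); last by apply/funext => x /=; rewrite rV_consK.
by rewrite preimage_id product_measure1E// lte_mul_pinfty// ge0_fin_numE.
Qed.

HB.instance Definition _ := Measure_isSigmaFinite.Build _ _ _ lebesgue_rVS
  lebesgue_rVS_sigma_finite.

End lebesgue_rVS.

Section lebesgue_rV0.
Context {R : realType}.

Definition lebesgue_rV0 : set 'rV[R]_0 -> \bar R := dirac (0 : 'rV[R]_0).
HB.instance Definition _ := Measure.on lebesgue_rV0.

Let lebesgue_rV0_sigma_finite : sigma_finite setT lebesgue_rV0.
Proof.
apply: fin_num_fun_sigma_finite; first by rewrite measure0.
by move=> A _; rewrite /lebesgue_rV0 diracE.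
Qed.

HB.instance Definition _ := Measure_isSigmaFinite.Build _ _ _ lebesgue_rV0
  lebesgue_rV0_sigma_finite.

End lebesgue_rV0.

Fixpoint lebesgue_rV {R : realType} n :
    {sigma_finite_measure set 'rV[R]_n -> \bar R} :=
  if n is k.+1 then lebesgue_rVS (lebesgue_rV k) else lebesgue_rV0.

Lemma lebesgue_rV_box {R : realType} n (A : 'I_n -> set R) :
  (forall i, measurable (A i)) ->
  lebesgue_rV n [set x : 'rV[R]_n | forall i, A i (x ord0 i)] =
  (\prod_(i < n) lebesgue_measure (A i))%E.
Proof.
elim: n A => [|n IHn] A mA /=.
  rewrite big_ord0 /lebesgue_rV0 diracE mem_set// => -[].
  by [].
rewrite big_ord_recl -IHn// /lebesgue_rVS /pushforward.
rewrite -product_measure1E//; last first.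
  rewrite (_ : mkset _ = \bigcap_(i in [set: 'I_n])
      (fun y : 'rV[R]_n => y ord0 i) @^-1` A (lift ord0 i)).
    apply: fin_bigcap_measurable => // i _; rewrite -[X in measurable X]setTI.
    by apply: measurable_coord => //; exact: mA.
  by apply/seteqP; split => y /= yA i => [_|]; [exact: yA|exact: (yA i Logic.I)].
  exact: mA.
congr (_ _); apply/seteqP; split => -[x v] /=.
  move=> xvA; split => /=.
    by have := xvA ord0; rewrite mxE unlift_none.
  by move=> i; have := xvA (lift ord0 i); rewrite mxE liftK.
move=> [/= xA vA] i; rewrite mxE.
by case: (unliftP ord0 i) => [j ->|->]; [exact: vA|].
Qed.

Section fractional_sobolev.
Context {R : realType} {n : nat}.
Implicit Types (U Omega : set 'rV[R]_n) (u phi : 'rV[R]_n -> R) (s p : R).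

(* The Euclidean norm; the library norm on ['rV[R]_n] is the sup norm, which
   induces the same topology. *)
Definition enorm (x : 'rV[R]_n) : R := Num.sqrt (\sum_(i < n) x ord0 i ^+ 2).

Definition boundary U : set 'rV[R]_n := closure U `\` interior U.

Definition dist_boundary U (x : 'rV[R]_n) : R :=
  inf [set enorm (x - y) | y in boundary U].

(* [iter_partial [:: i1; ...; ik] u] is d_{i1} ... d_{ik} u. *)
Definition iter_partial (l : seq 'I_n) u : 'rV[R]_n -> R :=
  foldr (fun i (f : 'rV[R]_n -> R) => 'D_(delta_mx ord0 i) f) u l.

Definition smooth u : Prop := forall l : seq 'I_n,
  continuous (iter_partial l u) /\
  forall i x, derivable (iter_partial l u) x (delta_mx ord0 i).

(* C_c^oo(Omega), its elements being extended by zero to R^n. *)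
Definition Cc_smooth Omega : set ('rV[R]_n -> R) := [set phi |
  let supp := closure [set x | phi x != 0] in
  [/\ smooth phi, compact supp & supp `<=` Omega]].

Local Open Scope ereal_scope.

(* [u]_{s,p,U}^p. On the diagonal the integrand is 0 / 0 = 0. *)
Definition gagliardo s p U u : \bar R :=
  \int[lebesgue_rV n]_(x in U) \int[lebesgue_rV n]_(y in U)
    (`|u x - u y| `^ p / enorm (x - y) `^ (n%:R + s * p))%:E.

Definition sobolev_norm s p U u : \bar R :=
  (\int[lebesgue_rV n]_(x in U) (`|u x| `^ p)%:E + gagliardo s p U u) `^ p^-1.

(* The closure of C_c^oo(Omega) for the norm of W^{s,p}(U). Classes of functions
   on U modulo null sets are given by their Borel representatives, with
   arbitrary values outside U. *)
Definition closure_Cc s p Omega U : set ('rV[R]_n -> R) := [set u : 'rV[R]_n -> R |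
  measurable_fun U u /\
  forall e : R, (0 < e)%R -> exists2 phi, Cc_smooth Omega phi &
    sobolev_norm s p U (fun x => u x - phi x)%R < e%:E].

Definition W0 s p Omega := closure_Cc s p Omega Omega.

Definition WOmega s p Omega := closure_Cc s p Omega setT.

Definition hardy_integral s p Omega u : \bar R :=
  \int[lebesgue_rV n]_(x in Omega)
    (`|u x| `^ p / dist_boundary Omega x `^ (s * p))%:E.

End fractional_sobolev.

(* Main.v *)
Require Import Defs.
From mathcomp Require Import all_boot all_order all_algebra.
From mathcomp Require Import all_classical all_reals all_analysis.
From mathcomp Require Import measurable_realfun ring lra.
Set Implicit Arguments.
Unset Strict Implicit.
Unset Printing Implicit Defensive.
Import Order.TTheory GRing.Theory Num.Theory.
Import numFieldNormedType.Exports.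
Local Open Scope classical_set_scope.
Local Open Scope ring_scope.

(** Only the regional inequality needs a proof: for a function in the closure
    of the test functions for the norm over R^n, passing from R^n to Omega
    decreases both the norm and the Gagliardo seminorm, so the same constant
    serves for the first inequality.

    Write d for the distance to the boundary, H for the Hardy integral of u, G
    for its Gagliardo seminorm over Omega.  The proof moves mass towards the
    boundary.  Fix a small scale lam in ]0, 1].  To a point x of Omega is
    attached the set S(x) of the points y of Omega with d y of order
    lam * d x and |x - y| <= d x; it contains a cube of side of order
    lam * d x, centred on the segment from x to an almost nearest boundary
    point.  Averaging |u x|^p <= 2^p (|u x - u y|^p + |u y|^p) over y in S(x),
    dividing by (d x)^(sp) and integrating in x gives two terms.  The first is
    bounded by G, because |x - y| <= d x on S(x).  In the second Tonelli's
    theorem puts the integral in x inside: the points x with y in S(x) are in a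
    cube around y of side of order d y / lam, and d x is of order d y / lam for
    them, so that this term is at most A * lam^(sp - n) * H, where A depends on
    n, s, p only.  This is [hardy_absorb].  Since sp > n, some lam makes the
    coefficient at most 1/2 ([contraction_scale]), and H is absorbed as soon as
    it is finite ([hardy_of_finite]).

    H is finite for a test function, which vanishes near the boundary
    ([hardy_Cc_smooth_lty]).  The inequality extends to the closure
    ([hardy_closure]): on {d >= 1/(j+1)} the Hardy weight is bounded, so the
    Hardy integral over this set is controlled by the L^p norm; letting first
    the approximation error tend to 0 and then j to infinity concludes. *)

(** * The Euclidean norm and the distance to the boundary *)

Section euclidean_norm.
Context {R : realType} {n : nat}.
Implicit Types x y z : 'rV[R]_n.

Lemma enorm_ge0 x : 0 <= enorm x.
Proof. exact: sqrtr_ge0. Qed.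

Lemma sqr_enorm x : enorm x ^+ 2 = \sum_(i < n) x ord0 i ^+ 2.
Proof. by rewrite sqr_sqrtr// sumr_ge0// => i _; exact: sqr_ge0. Qed.

Lemma enormZ (a : R) x : enorm (a *: x) = `|a| * enorm x.
Proof.
rewrite /enorm -sqrtr_sqr -sqrtrM ?sqr_ge0//; congr Num.sqrt.
by rewrite mulr_sumr; apply: eq_bigr => i _; rewrite mxE exprMn.
Qed.

Lemma enormN x : enorm (- x) = enorm x.
Proof. by rewrite -scaleN1r enormZ normrN1 mul1r. Qed.

Lemma enorm_distC x y : enorm (x - y) = enorm (y - x).
Proof. by rewrite -enormN opprB. Qed.

Lemma coord_le_enorm x i : `|x ord0 i| <= enorm x.
Proof.
rewrite -sqrtr_sqr; apply: ler_wsqrtr; rewrite (bigD1 i)//= lerDl.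
by apply: sumr_ge0 => j _; exact: sqr_ge0.
Qed.

(** Cauchy-Schwarz: expand the square norm of |y| x - |x| y. *)
Lemma dot_le_enorm x y : \sum_(i < n) x ord0 i * y ord0 i <= enorm x * enorm y.
Proof.
have [x0|x0] := eqVneq (enorm x) 0.
  rewrite x0 mul0r big1// => i _; have := coord_le_enorm x i.
  by rewrite x0 normr_le0 => /eqP ->; rewrite mul0r.
have [y0|y0] := eqVneq (enorm y) 0.
  rewrite y0 mulr0 big1// => i _; have := coord_le_enorm y i.
  by rewrite y0 normr_le0 => /eqP ->; rewrite mulr0.
have xy0 : 0 < enorm x * enorm y.
  by rewrite mulr_gt0// lt_neqAle enorm_ge0 andbT eq_sym.
have : 0 <= \sum_(i < n) (enorm y * x ord0 i - enorm x * y ord0 i) ^+ 2.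
  by apply: sumr_ge0 => i _; exact: sqr_ge0.
rewrite (_ : \sum_(i < n) _ = (enorm x * enorm y) *
    (2 * (enorm x * enorm y - \sum_(i < n) x ord0 i * y ord0 i))); last first.
  transitivity (enorm y ^+ 2 * \sum_(i < n) x ord0 i ^+ 2
      + enorm x ^+ 2 * \sum_(i < n) y ord0 i ^+ 2
      - 2 * enorm x * enorm y * \sum_(i < n) x ord0 i * y ord0 i).
    rewrite !mulr_sumr -sumrN -!big_split/=; apply: eq_bigr => i _; ring.
  rewrite -!sqr_enorm; ring.
by rewrite pmulr_rge0// pmulr_rge0// subr_ge0.
Qed.

Lemma ler_enormD x y : enorm (x + y) <= enorm x + enorm y.
Proof.
rewrite -(@ler_pXn2r _ 2)// ?nnegrE ?addr_ge0 ?enorm_ge0//.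
rewrite sqrrD !sqr_enorm.
rewrite (_ : \sum_(i < n) (x + y) ord0 i ^+ 2 = \sum_(i < n) x ord0 i ^+ 2
    + (\sum_(i < n) x ord0 i * y ord0 i) *+ 2 + \sum_(i < n) y ord0 i ^+ 2).
  by rewrite lerD2r lerD2l lerMn2r dot_le_enorm orbT.
rewrite -sumrMnl -!big_split/=; apply: eq_bigr => i _; rewrite mxE sqrrD; ring.
Qed.

Lemma ler_enorm_distD z x y : enorm (x - y) <= enorm (x - z) + enorm (z - y).
Proof. by rewrite -[x - y](subrKA z); exact: ler_enormD. Qed.

(** The factor sqrt n would be sharp; [n.+1] avoids a square root and can be
    divided by in every dimension. *)
Lemma enorm_le_coord x (r : R) : 0 <= r -> (forall i, `|x ord0 i| <= r) ->
  enorm x <= n.+1%:R * r.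
Proof.
move=> r0 xr; rewrite -(@ler_pXn2r _ 2)// ?nnegrE ?enorm_ge0 ?mulr_ge0//.
rewrite sqr_enorm (@le_trans _ _ (\sum_(i < n) r ^+ 2))//.
  by apply: ler_sum => i _; rewrite -real_normK ?num_real// ler_pXn2r ?nnegrE.
rewrite sumr_const card_ord exprMn -[leLHS]mulr_natl; apply: ler_wpM2r.
  exact: sqr_ge0.
by rewrite -natrX ler_nat (leq_trans (leqnSn n))// leq_pmulr.
Qed.

Lemma ball_enorm x y (e : R) : ball x e y -> 0 < e -> enorm (y - x) <= n.+1%:R * e.
Proof.
move=> [_ xy] e0; apply: enorm_le_coord; first exact: ltW.
by move=> i; have := xy ord0 i; rewrite !mxE /ball/= distrC => /ltW.
Qed.

Lemma enorm_ball x y (e : R) : enorm (y - x) < e -> ball x e y.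
Proof.
move=> xy; split; first exact: le_lt_trans (enorm_ge0 _) xy.
move=> i j; rewrite (ord1 i) /ball/= distrC.
by apply: le_lt_trans xy; have := coord_le_enorm (y - x) j; rewrite !mxE.
Qed.

End euclidean_norm.

Section distance_to_boundary.
Context {R : realType} {n : nat}.
Implicit Types (x y z : 'rV[R]_n) (Omega : set 'rV[R]_n).

(** The last parameter of the segment that is a limit of parameters of points
    of Omega gives a boundary point: it is in the closure of Omega, and if it
    were in the open set Omega the segment would stay in Omega a bit longer. *)
Lemma segment_meets_boundary Omega x y : open Omega -> Omega x -> ~ Omega y ->
  exists2 t, 0 <= t <= 1 & boundary Omega (x + t *: (y - x)).
Proof.
move=> oO Ox nOy.
pose g (t : R) := x + t *: (y - x).
have cg : continuous g.
  by move=> t; apply: cvgD; [exact: cvg_cst|exact: scalel_continuous].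
pose T := [set t : R | 0 <= t <= 1 /\ Omega (g t)].
have T0 : T 0 by split; rewrite ?lexx ?ler01// /g scale0r addr0.
have Tub : ubound T 1 by move=> t [/andP[]].
have hsT : has_sup T by split; [exists 0|exists 1].
have s01 : 0 <= sup T <= 1.
  by rewrite ub_le_sup//= ?ge_sup//; [exists 0|exists 1].
exists (sup T) => //; split.
  have : closure T (sup T) by apply: closure_sup; [exists 0|exists 1].
  move=> clT B /(cg (sup T)) nB; have [t [[_ Ot] Bt]] := clT _ nB.
  by exists (g t).
rewrite ((interior_id _).1 oO) => Os.
have : nbhs (sup T) (g @^-1` Omega).
  by apply: cg; exact: open_nbhs_nbhs.
move=> /nbhs_ballP[e /= e0 se].
have s1 : sup T < 1.
  move: s01 => /andP[_]; rewrite le_eqVlt => /predU1P[s1|//].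
  by move: Os; rewrite -/(g _) s1 /g scale1r addrC subrK.
pose t := Num.min (sup T + e / 2) 1.
have st : sup T < t by rewrite lt_min s1 andbT ltrDl divr_gt0.
have : T t.
  split.
    rewrite ge_min lexx orbT andbT; apply: le_trans (ltW st).
    by case/andP: s01.
  apply: se; rewrite /ball/= ltr_distlC; apply/andP; split.
    by apply: lt_trans st; rewrite ltrBlDr ltrDl.
  by rewrite gt_min ltrD2l ltr_pdivrMr// ltr_pMr// ltr1n.
move=> /(ub_le_sup _) => /(_ (ex_intro _ 1 Tub)).
by rewrite leNgt st.
Qed.

Lemma boundary_neq0 Omega x : open Omega -> Omega <> setT -> Omega x ->
  boundary Omega !=set0.
Proof.
move=> oO OT Ox.
have [y nOy] : exists y, ~ Omega y.
  by apply/existsNP => OT'; apply: OT; apply/seteqP; split.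
by have [t _ bt] := segment_meets_boundary oO Ox nOy; exists (x + t *: (y - x)).
Qed.


Lemma dist_boundary_ge0 Omega x : 0 <= dist_boundary Omega x.
Proof.
have [[e Ee]|E0] := pselect ([set enorm (x - y) | y in boundary Omega] !=set0).
  by apply: lb_le_inf; [exists e|move=> _ [z _ <-]; exact: enorm_ge0].
rewrite /dist_boundary (_ : [set _ | _ in _] = set0) ?inf0//.
by apply/seteqP; split => // e Ee; case: E0; exists e.
Qed.

Lemma dist_boundary_le Omega x z : boundary Omega z ->
  dist_boundary Omega x <= enorm (x - z).
Proof.
move=> bz; apply: ge_inf; last by exists z.
by exists 0 => _ [y _ <-]; exact: enorm_ge0.
Qed.

Lemma dist_boundary_adherent Omega x (e : R) : boundary Omega !=set0 -> 0 < e ->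
  exists2 z, boundary Omega z & enorm (x - z) < dist_boundary Omega x + e.
Proof.
move=> [z bz] e0.
have [|_ [y by_ <-] ye] :=
  @inf_adherent _ [set enorm (x - y) | y in boundary Omega] _ e0.
  split; first by exists (enorm (x - z)); exists z.
  by exists 0 => _ [y _ <-]; exact: enorm_ge0.
by exists y.
Qed.

(** This holds even for an empty boundary, where the infimum of the empty set
    is 0 by convention. *)
Lemma dist_boundary_lip Omega x y :
  dist_boundary Omega x <= dist_boundary Omega y + enorm (x - y).
Proof.
have [b0|b0] := pselect (boundary Omega !=set0); last first.
  have -> : dist_boundary Omega x = 0.
    rewrite /dist_boundary (_ : [set _ | _ in _] = set0) ?inf0//.
    by apply/seteqP; split => // r [z bz _]; case: b0; exists z.
  by rewrite addr_ge0 ?enorm_ge0 ?dist_boundary_ge0.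
apply/ler_addgt0Pr => e e0.
have [z bz yz] := dist_boundary_adherent y b0 e0.
have := dist_boundary_le x bz; have := ler_enorm_distD y x z; lra.
Qed.

Lemma dist_boundary_gt0 Omega x : open Omega -> boundary Omega !=set0 ->
  Omega x -> 0 < dist_boundary Omega x.
Proof.
move=> oO b0 Ox.
have /nbhs_ballP[e /= e0 xe] : nbhs x Omega by exact: open_nbhs_nbhs.
apply: (lt_le_trans e0).
apply: lb_le_inf; first by case: b0 => z bz; exists (enorm (x - z)), z.
move=> _ [z [_ +] <-]; rewrite ((interior_id _).1 oO) => nOz.
rewrite leNgt; apply/negP; rewrite enorm_distC => /enorm_ball.
by move=> /xe.
Qed.

(** A segment that leaves Omega crosses the boundary, hence has length at
    least the distance to the boundary. *)
Lemma ball_dist_boundary Omega x y : open Omega -> Omega x ->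
  enorm (y - x) < dist_boundary Omega x -> Omega y.
Proof.
move=> oO Ox; rewrite ltNge => xy; apply: contrapT => nOy.
have [t /andP[t0 t1] bt] := segment_meets_boundary oO Ox nOy.
move/negP: xy; apply; apply: (le_trans (dist_boundary_le x bt)).
rewrite opprD addNKr enormN enormZ ger0_norm//.
by rewrite ler_piMl// enorm_ge0.
Qed.

Lemma continuous_dist_boundary Omega : continuous (dist_boundary Omega).
Proof.
move=> x; have fx := nbhs_filter x.
apply/(cvgrPdist_le (FF := fx)) => /= e e0.
have d0 : 0 < e / n.+1%:R by rewrite divr_gt0.
apply/nbhs_ballP; exists (e / n.+1%:R) => //= y /ball_enorm/(_ d0).
rewrite mulrCA divff ?mulr1 ?pnatr_eq0// => xy.
have yx := dist_boundary_lip Omega y x; have := dist_boundary_lip Omega x y.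
by rewrite enorm_distC => xy'; rewrite ler_norml; apply/andP; split; lra.
Qed.

Lemma continuous_measurable_rV (f : 'rV[R]_n -> R) : continuous f ->
  measurable_fun setT f.
Proof.
move=> cf; apply: (measurability _ (RGenOpens.measurableE R)) => _ [_ [a [b ->] <-]].
rewrite setTI; apply: open_measurable_rV.
by apply: open_comp; [move=> + _; exact: cf|exact: interval_open].
Qed.

Lemma measurable_dist_boundary Omega : measurable_fun setT (dist_boundary Omega).
Proof. by apply: continuous_measurable_rV; exact: continuous_dist_boundary. Qed.

End distance_to_boundary.

(** * Tonelli's theorem on a product of measurable sets *)

Section tonelli_on_sets.
Local Open Scope ereal_scope.
Context d1 d2 (T1 : measurableType d1) (T2 : measurableType d2) (R : realType).
Context (m1 : {sigma_finite_measure set T1 -> \bar R})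
        (m2 : {sigma_finite_measure set T2 -> \bar R}).
Context (f : T1 * T2 -> \bar R).
Hypothesis mf : measurable_fun setT f.
Hypothesis f0 : forall z, 0 <= f z.

Lemma measurable_fun_integral_in (B : set T2) : measurable B ->
  measurable_fun setT (fun x => \int[m2]_(y in B) f (x, y)).
Proof.
move=> mB.
have mfB : measurable_fun setT (f \_ ([set: T1] `*` B)).
  have mTB : measurable ([set: T1] `*` B) by apply: measurableX.
  exact: (iffLR (measurable_restrictT f mTB) (measurable_funTS mf)).
have mF := measurable_fun_fubini_tonelli_F (m2 := m2) _ mfB
  (erestrict_ge0 (fun z _ => f0 z)).
apply: eq_measurable_fun mF => x _; rewrite /fubini_F [RHS]integral_mkcond.
by apply: eq_integral => y _; rewrite !patchE in_setX in_setT.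
Qed.

Lemma fubini_tonelli_in (A : set T1) (B : set T2) : measurable A -> measurable B ->
  \int[m1]_(x in A) \int[m2]_(y in B) f (x, y) =
  \int[m2]_(y in B) \int[m1]_(x in A) f (x, y).
Proof.
move=> mA mB.
have mfAB : measurable_fun setT (f \_ (A `*` B)).
  have mAB : measurable (A `*` B) by apply: measurableX.
  exact: (iffLR (measurable_restrictT f mAB) (measurable_funTS mf)).
transitivity (\int[m1]_x \int[m2]_y (f \_ (A `*` B)) (x, y)).
  rewrite [LHS]integral_mkcond; apply: eq_integral => x _; rewrite [LHS]patchE.
  case: ifPn => xA; last first.
    by apply/esym; apply: integral0_eq => y _; rewrite patchE in_setX (negbTE xA).
  rewrite [LHS]integral_mkcond.
  by apply: eq_integral => y _; rewrite !patchE in_setX xA.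
rewrite (fubini_tonelli _ mfAB (erestrict_ge0 (fun z _ => f0 z))).
rewrite [RHS]integral_mkcond; apply: eq_integral => y _; rewrite [RHS]patchE.
case: ifPn => yB; last first.
  by apply: integral0_eq => x _; rewrite patchE in_setX (negbTE yB) andbF.
rewrite [RHS]integral_mkcond.
by apply: eq_integral => x _; rewrite !patchE in_setX yB andbT.
Qed.

End tonelli_on_sets.

(** * Moving towards the boundary at scale lam *)

Section inward_set.
Context {R : realType} {n : nat}.
Implicit Types (x y z c : 'rV[R]_n) (Omega : set 'rV[R]_n).
Let leb := @lebesgue_rV R n.

Definition cube c (r : R) : set 'rV[R]_n :=
  [set x | forall i, (x ord0 i) \in `[c ord0 i - r, c ord0 i + r]].

Lemma lebesgue_cube c (r : R) : 0 <= r -> leb (cube c r) = ((r *+ 2) ^+ n)%:E.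
Proof.
move=> r0.
rewrite /leb (@lebesgue_rV_box R n (fun i => `[c ord0 i - r, c ord0 i + r]%classic)).
  rewrite (eq_bigr (fun=> (r *+ 2)%:E)); last first.
    move=> i _; rewrite lebesgue_measure_itv/= lte_fin.
    case: ltP => [_|].
      by rewrite -EFinB; congr EFin; rewrite mulr2n; ring.
    move=> h; have -> : r = 0 by lra.
    by rewrite mul0rn.
  by rewrite prodEFin prodr_const card_ord.
by move=> i; exact: measurable_itv.
Qed.

Lemma measurable_cube c (r : R) : measurable (cube c r).
Proof.
rewrite (_ : cube c r = \bigcap_(i in [set: 'I_n])
    (fun y : 'rV[R]_n => y ord0 i) @^-1` `[c ord0 i - r, c ord0 i + r]).
  apply: fin_bigcap_measurable => // i _; rewrite -[X in measurable X]setTI.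
  by apply: measurable_coord => //; exact: measurable_itv.
by apply/seteqP; split => y /= cy i => [_|]; [exact: cy|exact: (cy i Logic.I)].
Qed.

Lemma enorm_cube c y (r : R) : 0 <= r -> cube c r y -> enorm (y - c) <= n.+1%:R * r.
Proof.
move=> r0 cy; apply: enorm_le_coord => // i; have := cy i.
by rewrite in_itv/= !mxE ler_distlC => /andP[? ?]; apply/andP; split; lra.
Qed.

Lemma cube_enorm c y (r : R) : enorm (y - c) <= r -> cube c r y.
Proof.
move=> yc i; have := le_trans (coord_le_enorm _ i) yc.
by rewrite in_itv/= !mxE ler_distlC => /andP[? ?]; apply/andP; split; lra.
Qed.

(** The pairs (x, y) with y in S(x), that is, such that y is closer to the
    boundary than x by a factor of order lam.  The bounds are stated in terms of
    the distances only, and not of a nearest boundary point of x, so that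
    measurability in (x, y) needs no measurable choice. *)
Definition inward Omega (lam : R) : set ('rV[R]_n * 'rV[R]_n) :=
  [set z | let d := dist_boundary Omega in
    [/\ Omega z.2, lam / 4 * d z.1 <= d z.2, d z.2 <= 2 * lam * d z.1
      & enorm (z.1 - z.2) <= d z.1]].

(** The centre divides the segment from an almost nearest boundary point z to x
    in the ratio lam : 1 - lam.  The cube lies in the ball of radius
    lam * d x / 2 around it, hence in the ball B(x, d x), which is in Omega. *)
Lemma cube_sub_inward Omega (lam : R) x : open Omega -> boundary Omega !=set0 ->
  0 < lam <= 1 -> Omega x ->
  exists c, cube c (lam * dist_boundary Omega x / (2 * n.+1%:R)) `<=`
    [set y | inward Omega lam (x, y)].
Proof.
move=> oO b0 /andP[lam0 lam1] Ox.
have dx0 := dist_boundary_gt0 oO b0 Ox.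
set dx := dist_boundary Omega x in dx0 *.
(* The excess lam / 4 is small enough for the ball of radius lam * dx / 2 around
   the centre to stay at distance lam / 4 * dx from the sphere of B(x, dx). *)
have e0 : 0 < lam / 4 * dx by rewrite mulr_gt0// divr_gt0.
have [z bz xz] := dist_boundary_adherent x b0 e0.
rewrite -/dx in xz.
exists (z + lam *: (x - z)) => y /enorm_cube.
have r0 : 0 <= lam * dx / (2 * n.+1%:R).
  by rewrite divr_ge0// mulr_ge0// ltW.
move=> /(_ r0).
rewrite (_ : _ * _ = lam * dx / 2); last by field; rewrite nat1r pnatr_eq0.
set c := z + _ => yc.
have xc : enorm (x - c) <= (1 - lam) * enorm (x - z).
  rewrite (_ : x - c = (1 - lam) *: (x - z)); last first.
    by rewrite /c scalerBl scale1r opprD addrA.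
  by rewrite enormZ ger0_norm// subr_ge0.
have cz : enorm (c - z) = lam * enorm (x - z).
  by rewrite /c [z + _]addrC addrK enormZ gtr0_norm.
have yz := ler_enorm_distD c y z.
have xy := ler_enorm_distD c x y.
rewrite (enorm_distC c y) in xy.
have dyz := dist_boundary_le y bz.
have dxy := dist_boundary_lip Omega x y.
have xydx : enorm (x - y) <= (1 - lam / 4) * dx by rewrite -/dx in dxy; nra.
split => /=; rewrite -/dx.
- by apply: (ball_dist_boundary oO Ox); rewrite enorm_distC -/dx; nra.
- by rewrite -/dx in dxy; nra.
- by nra.
- by nra.
Qed.

End inward_set.

(** * Power functions and measurability of the integrands *)

Section powR_facts.
Context {R : realType}.
Implicit Types a b p r : R.

(** |a + b| is at most twice the larger of |a| and |b|. *)
Lemma powR_normD a b p : 0 <= p -> `|a + b| `^ p <= 2 `^ p * (`|a| `^ p + `|b| `^ p).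
Proof.
move=> p0; pose M := Num.max `|a| `|b|.
have M0 : 0 <= M by rewrite le_max normr_ge0.
apply: (@le_trans _ _ ((2 * M) `^ p)).
  apply: ge0_ler_powR; rewrite ?nnegrE ?mulr_ge0//.
  apply: (le_trans (ler_normD a b)).
  have : `|a| <= M by rewrite le_max lexx.
  have : `|b| <= M by rewrite le_max lexx orbT.
  lra.
rewrite powRM//; apply: ler_wpM2l; first exact: powR_ge0.
have := powR_ge0 `|a| p; have := powR_ge0 `|b| p.
by rewrite /M; case: (leP `|a| `|b|) => _; lra.
Qed.

Lemma powR_inv_le a b r : 0 <= r -> 0 < a -> a <= b -> (b `^ r)^-1 <= (a `^ r)^-1.
Proof.
move=> r0 a0 ab; have b0 := lt_le_trans a0 ab.
by rewrite lef_pV2 ?posrE ?powR_gt0// ge0_ler_powR// nnegrE ltW.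
Qed.

End powR_facts.

Section measurability.
Context {R : realType} {n : nat}.
Implicit Types (Omega : set 'rV[R]_n) (u : 'rV[R]_n -> R).
Local Notation V := 'rV[R]_n.

Lemma measurable_fun_powR d (T : measurableType d) (f : T -> R) (r : R) :
  measurable_fun setT f -> measurable_fun setT (fun t => f t `^ r).
Proof. by move=> mf; exact: (measurableT_comp (measurable_powR r) mf). Qed.

Lemma measurable_fun_powRV d (T : measurableType d) (f : T -> R) (r : R) :
  measurable_fun setT f -> measurable_fun setT (fun t => (f t `^ r)^-1).
Proof.
by move=> mf; under eq_fun do rewrite -powRN; exact: measurable_fun_powR.
Qed.

Lemma measurable_fun_normr d (T : measurableType d) (f : T -> R) :
  measurable_fun setT f -> measurable_fun setT (fun t => `|f t|).
Proof. by move=> mf; exact: (measurableT_comp (@normr_measurable R setT) mf). Qed.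

Lemma measurable_fst_comp u : measurable_fun setT u ->
  measurable_fun [set: V * V] (fun z => u z.1).
Proof. by move=> mu; exact: (measurableT_comp mu (@measurable_fst _ _ V V)). Qed.

Lemma measurable_snd_comp u : measurable_fun setT u ->
  measurable_fun [set: V * V] (fun z => u z.2).
Proof. by move=> mu; exact: (measurableT_comp mu (@measurable_snd _ _ V V)). Qed.

Lemma measurable_enormB :
  measurable_fun [set: V * V] (fun z => enorm (z.1 - z.2)).
Proof.
have msqrt := continuous_measurable_fun (@sqrt_continuous R).
apply: (measurableT_comp msqrt).
apply: measurable_sum => i; apply: measurable_funX.
under eq_fun do rewrite !mxE.
apply: measurable_funB.
  exact: (measurable_fst_comp (measurable_coord i)).
exact: (measurable_snd_comp (measurable_coord i)).
Qed.

Lemma measurable_gagliardo_integrand u (p r : R) : measurable_fun setT u ->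
  measurable_fun [set: V * V]
    (fun z => `|u z.1 - u z.2| `^ p / enorm (z.1 - z.2) `^ r).
Proof.
move=> mu; apply: measurable_funM.
  apply: measurable_fun_powR; apply: measurable_fun_normr.
  by apply: measurable_funB; [exact: measurable_fst_comp|exact: measurable_snd_comp].
by apply: measurable_fun_powRV; exact: measurable_enormB.
Qed.

Lemma measurable_hardy_integrand Omega u (p r : R) : measurable_fun setT u ->
  measurable_fun setT (fun x => `|u x| `^ p / dist_boundary Omega x `^ r).
Proof.
move=> mu; apply: measurable_funM.
  by apply: measurable_fun_powR; exact: measurable_fun_normr.
by apply: measurable_fun_powRV; exact: measurable_dist_boundary.
Qed.

Lemma measurable_inward Omega (lam : R) : open Omega ->
  measurable (inward Omega lam).
Proof.
move=> oO; have mO := open_measurable_rV oO.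
have md := measurable_dist_boundary Omega.
have md1 := measurable_fst_comp md; have md2 := measurable_snd_comp md.
have mle (f g : V * V -> R) : measurable_fun setT f -> measurable_fun setT g ->
    measurable [set z | f z <= g z].
  by move=> mf mg; have := measurable_fun_le measurableT mf mg; rewrite setTI.
rewrite (_ : inward Omega lam = (setT `*` Omega) `&`
   ([set z | lam / 4 * dist_boundary Omega z.1 <= dist_boundary Omega z.2] `&`
   ([set z | dist_boundary Omega z.2 <= 2 * lam * dist_boundary Omega z.1] `&`
    [set z | enorm (z.1 - z.2) <= dist_boundary Omega z.1]))); last first.
  apply/seteqP; split => z /=; first by case.
  by move=> [[_ ?] [? [? ?]]]; split.
apply: measurableI; first exact: measurableX.
apply: measurableI; first by apply: mle => //; exact: measurable_funM.
apply: measurableI; first by apply: mle => //; exact: measurable_funM.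
by apply: mle => //; exact: measurable_enormB.
Qed.

End measurability.

(** * Size of the slices of the inward relation *)

Section inward_measure.
Context {R : realType} {n : nat}.
Context (Omega : set 'rV[R]_n) (lam : R).
Hypothesis oO : open Omega.
Hypothesis b0 : boundary Omega !=set0.
Hypothesis lam01 : 0 < lam <= 1.
Let leb := @lebesgue_rV R n.
Let d := dist_boundary Omega.

Lemma measurable_inward_from x : measurable [set y | inward Omega lam (x, y)].
Proof.
have := measurable_xsection x (measurable_inward lam oO).
by congr measurable; apply/seteqP; split => y; rewrite /xsection/= inE.
Qed.

Lemma measurable_inward_to y : measurable [set x | inward Omega lam (x, y)].
Proof.
have := measurable_ysection y (measurable_inward lam oO).
by congr measurable; apply/seteqP; split => x; rewrite /ysection/= inE.
Qed.

Lemma inward_from_measure_ge x : Omega x ->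
  (((lam * d x / n.+1%:R) ^+ n)%:E <= leb [set y | inward Omega lam (x, y)])%E.
Proof.
move=> Ox; have [c cE] := cube_sub_inward oO b0 lam01 Ox.
have /andP[lam0 _] := lam01.
have r0 : 0 <= lam * d x / (2 * n.+1%:R).
  by rewrite divr_ge0// mulr_ge0 ?dist_boundary_ge0// ltW.
have -> : lam * d x / n.+1%:R = (lam * d x / (2 * n.+1%:R)) *+ 2.
  by rewrite mulr2n; field; rewrite nat1r pnatr_eq0.
rewrite -(lebesgue_cube c r0); apply: le_measure cE; rewrite inE.
- exact: measurable_cube.
- exact: measurable_inward_from.
Qed.

(** If y is in S(x) then |x - y| <= d x <= 4 * d y / lam. *)
Lemma inward_to_measure_le y :
  (leb [set x | inward Omega lam (x, y)] <= ((8 * d y / lam) ^+ n)%:E)%E.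
Proof.
have /andP[lam0 _] := lam01.
have r0 : 0 <= 4 * d y / lam.
  by rewrite divr_ge0 ?mulr_ge0 ?dist_boundary_ge0// ltW.
have -> : 8 * d y / lam = (4 * d y / lam) *+ 2.
  by rewrite mulr2n; field; rewrite gt_eqF.
rewrite -(lebesgue_cube y r0); apply: le_measure.
- by rewrite inE; exact: measurable_inward_to.
- by rewrite inE; exact: measurable_cube.
move=> x [_ /= h1 _ h2]; apply: cube_enorm; apply: (le_trans h2).
by rewrite ler_pdivlMr// /d; lra.
Qed.

End inward_measure.

(** * The absorption estimate *)

Section hardy_absorption.
Context {R : realType} {n : nat}.
Context (Omega : set 'rV[R]_n) (lam s p : R) (u : 'rV[R]_n -> R).
Hypothesis oO : open Omega.
Hypothesis b0 : boundary Omega !=set0.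
Hypothesis lam01 : 0 < lam <= 1.
Hypothesis p0 : 0 < p.
Hypothesis s0 : 0 < s.
Hypothesis mu : measurable_fun setT u.
Local Notation V := 'rV[R]_n.
Let leb := @lebesgue_rV R n.
Let d := dist_boundary Omega.
Let N : R := n%:R + s * p.
Let mO : measurable Omega := open_measurable_rV oO.

Let gag (z : V * V) : R := `|u z.1 - u z.2| `^ p / enorm (z.1 - z.2) `^ N.

(** The transported mass: the part of |u y|^p that is charged to x. *)
Let trans (z : V * V) : R :=
  \1_(inward Omega lam) z * (`|u z.2| `^ p * (d z.1 `^ N)^-1).

Let hdy (x : V) : R := `|u x| `^ p / d x `^ (s * p).

(** [c0] bounds |S(x)| / (d x)^n from below; [C1] bounds the factor that the
    Hardy integral gains in the transport. *)
Let c0 : R := (lam / n.+1%:R) ^+ n.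
Let C1 : R := (2 * lam) `^ N * (8 / lam) ^+ n.

Let N0 : 0 < N. Proof. by rewrite ltr_wpDl// mulr_gt0. Qed.

Let gag_ge0 z : 0 <= gag z.
Proof. by rewrite divr_ge0 ?powR_ge0. Qed.

Let trans_ge0 z : 0 <= trans z.
Proof. by rewrite mulr_ge0// mulr_ge0 ?invr_ge0 ?powR_ge0. Qed.

Let hdy_ge0 x : 0 <= hdy x.
Proof. by rewrite divr_ge0 ?powR_ge0. Qed.

Let mgag : measurable_fun setT gag := measurable_gagliardo_integrand p N mu.

Let mtrans : measurable_fun setT trans.
Proof.
apply: measurable_funM.
  by apply: measurable_indic; exact: measurable_inward.
apply: measurable_funM.
  apply: measurable_fun_powR; apply: measurable_fun_normr.
  exact: measurable_snd_comp.
apply: measurable_fun_powRV.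
by apply: measurable_fst_comp; exact: measurable_dist_boundary.
Qed.

Let mhdy : measurable_fun setT hdy :=
  measurable_hardy_integrand Omega p (s * p) mu.

Let d_gt0 x : Omega x -> 0 < d x.
Proof. exact: dist_boundary_gt0. Qed.

Let dN x : Omega x -> d x `^ N = d x ^+ n * d x `^ (s * p).
Proof.
move=> Ox; have dx := d_gt0 Ox.
by rewrite /N powRD ?(gt_eqF dx) ?implybT// powR_mulrn// ltW.
Qed.

(** The weight (d x)^(- N) is dominated by |x - y|^(- N), as |x - y| <= d x. *)
Let pointwise x y : Omega x -> inward Omega lam (x, y) ->
  `|u x| `^ p * (d x `^ N)^-1 <= 2 `^ p * (gag (x, y) + trans (x, y)).
Proof.
move=> Ox Exy; have dx := d_gt0 Ox.
have dxN : 0 <= (d x `^ N)^-1 by rewrite invr_ge0 powR_ge0.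
have := powR_normD (u x - u y) (u y) (ltW p0); rewrite subrK.
move=> /(ler_wpM2r dxN)/le_trans; apply.
rewrite -mulrA ler_wpM2l ?powR_ge0// mulrDl.
rewrite /trans indicE mem_set// mul1r /= lerD2r /gag /=.
(* On the diagonal the Gagliardo integrand is 0 / 0 = 0. *)
have [->|xy] := eqVneq x y.
  by rewrite subrr normr0 powR0 ?gt_eqF// !mul0r.
rewrite ler_wpM2l ?powR_ge0//; apply: powR_inv_le; first exact: ltW.
- rewrite lt_neqAle enorm_ge0 andbT eq_sym; apply/negP => /eqP e0.
  move/negP: xy; apply; apply/eqP/rowP => i; apply/eqP; rewrite -subr_eq0.
  by have := coord_le_enorm (x - y) i; rewrite e0 !mxE normr_le0.
- by case: Exy.
Qed.

(** The left-hand side of [pointwise] is independent of y; integrating over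
    S(x) multiplies it by the measure of S(x), which is at least
    c0 * (d x)^n. *)
Let slice x : Omega x ->
  (c0%:E * (hdy x)%:E <=
   \int[leb]_(y in Omega) (2 `^ p * (gag (x, y) + trans (x, y)))%:E)%E.
Proof.
move=> Ox; have dx := d_gt0 Ox.
set f := fun y => (2 `^ p * (gag (x, y) + trans (x, y)))%:E.
have mf : measurable_fun setT f.
  apply/measurable_EFinP; apply: measurable_funM => //.
  by apply: measurable_funD; [exact: (measurableT_comp mgag (measurable_pair1 x))|
    exact: (measurableT_comp mtrans (measurable_pair1 x))].
have f0 y : (0 <= f y)%E by rewrite lee_fin mulr_ge0 ?powR_ge0 ?addr_ge0.
pose E := [set y | inward Omega lam (x, y)].
have mE : measurable E by exact: measurable_inward_from.
apply: (@le_trans _ _ (\int[leb]_(y in E) f y)%E); last first.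
  apply: ge0_subset_integral => //; first exact: measurable_funTS.
  by move=> y [].
apply: (@le_trans _ _
    (\int[leb]_(y in E) cst (`|u x| `^ p * (d x `^ N)^-1)%:E y)%E);
  last first.
  apply: ge0_le_integral => //.
  - by move=> y _; rewrite lee_fin mulr_ge0 ?invr_ge0 ?powR_ge0.
  - exact: measurable_funTS.
  - by move=> y Ey; rewrite lee_fin; exact: pointwise.
rewrite integral_cst//.
apply: le_trans (lee_wpmul2l _ (inward_from_measure_ge oO b0 lam01 Ox)); last first.
  by rewrite lee_fin mulr_ge0 ?invr_ge0 ?powR_ge0.
rewrite -!EFinM lee_fin -/d /hdy dN// /c0.
rewrite le_eqVlt; apply/orP; left; apply/eqP.
rewrite !expr_div_n exprMn.
field; rewrite -/d !expf_neq0 ?gt_eqF ?powR_gt0//=.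
Qed.

Let absorb_x :
  (c0%:E * \int[leb]_(x in Omega) (hdy x)%:E <=
   (2 `^ p)%:E * (\int[leb]_(x in Omega) \int[leb]_(y in Omega) (gag (x, y))%:E
     + \int[leb]_(x in Omega) \int[leb]_(y in Omega) (trans (x, y))%:E))%E.
Proof.
have lam0 : 0 < lam by case/andP: lam01.
have c00 : 0 <= c0 by rewrite exprn_ge0// divr_ge0// ltW.
have mG := measurable_fun_integral_in leb
  ((measurable_EFinP _ _).2 mgag) gag_ge0 mO.
have mK := measurable_fun_integral_in leb
  ((measurable_EFinP _ _).2 mtrans) trans_ge0 mO.
have mg1 x : measurable_fun Omega (fun y => (gag (x, y))%:E).
  apply: measurable_funTS; apply/measurable_EFinP.
  exact: (measurableT_comp mgag (measurable_pair1 x)).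
have mt1 x : measurable_fun Omega (fun y => (trans (x, y))%:E).
  apply: measurable_funTS; apply/measurable_EFinP.
  exact: (measurableT_comp mtrans (measurable_pair1 x)).
rewrite -ge0_integralD//; last first.
- exact: measurable_funTS.
- by move=> x _; apply: integral_ge0 => y _; rewrite lee_fin.
- exact: measurable_funTS.
- by move=> x _; apply: integral_ge0 => y _; rewrite lee_fin.
rewrite -!ge0_integralZl//; last first.
- by move=> x _; apply: adde_ge0; apply: integral_ge0 => y _; rewrite lee_fin.
- by apply: emeasurable_funD; exact: measurable_funTS.
- by move=> x _; rewrite lee_fin.
- by apply: measurable_funTS; apply/measurable_EFinP.
apply: ge0_le_integral => //.
- by move=> x _; rewrite mule_ge0// lee_fin.
- apply: measurable_funTS; apply: measurable_funeM.
  exact/measurable_EFinP.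
- apply: measurable_funTS; apply: measurable_funeM.
  by apply: emeasurable_funD.
move=> x Ox; apply: (le_trans (slice Ox)).
rewrite -ge0_integralD//; last 2 first.
- by move=> y _; rewrite lee_fin.
- by move=> y _; rewrite lee_fin.
rewrite -ge0_integralZl//; last first.
- by move=> y _; rewrite adde_ge0// lee_fin.
- exact: emeasurable_funD.
Qed.

(** After Tonelli's theorem, for fixed y, the integrand is at most the constant
    [k] below, because d y <= 2 * lam * d x, and it vanishes outside of a set of
    measure at most (8 * d y / lam)^n. *)
Let trans_bound :
  (\int[leb]_(x in Omega) \int[leb]_(y in Omega) (trans (x, y))%:E <=
   C1%:E * \int[leb]_(x in Omega) (hdy x)%:E)%E.
Proof.
have lam0 : 0 < lam by case/andP: lam01.
have C10 : 0 <= C1 by rewrite mulr_ge0 ?powR_ge0// exprn_ge0// divr_ge0// ltW.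
rewrite (fubini_tonelli_in leb leb (f := EFin \o trans))//; last first.
  exact/measurable_EFinP.
rewrite -ge0_integralZl//; last first.
- by move=> x _; rewrite lee_fin.
- by apply: measurable_funTS; apply/measurable_EFinP.
have mt2 y : measurable_fun setT (fun x => (trans (x, y))%:E).
  apply/measurable_EFinP; exact: (measurableT_comp mtrans (measurable_pair2 y)).
have mswap : measurable_fun setT (fun z : V * V => (trans (z.2, z.1))%:E).
  apply/measurable_EFinP.
  exact: (measurableT_comp mtrans (@measurable_swap _ _ V V)).
have mK := measurable_fun_integral_in leb mswap (fun z => trans_ge0 _) mO.
apply: ge0_le_integral => //.
- by move=> y _; apply: integral_ge0 => x _; rewrite lee_fin.
- exact: measurable_funTS.
- apply: measurable_funTS; apply: measurable_funeM.
  exact/measurable_EFinP.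
move=> y Oy; have dy := d_gt0 Oy.
pose k := `|u y| `^ p * ((2 * lam) `^ N / d y `^ N).
have k0 : 0 <= k by rewrite mulr_ge0 ?divr_ge0 ?powR_ge0.
pose E := [set x | inward Omega lam (x, y)].
have mE : measurable E by exact: measurable_inward_to.
apply: (@le_trans _ _ (\int[leb]_(x in Omega) (k%:E * (\1_E x)%:E))%E).
  apply: ge0_le_integral.
  - exact: mO.
  - by move=> x _; exact: (trans_ge0 (x, y)).
  - exact: (measurable_funTS (mt2 y)).
  - apply: measurable_funeM; apply/measurable_EFinP; exact: (measurable_indic mE).
  move=> x Ox; have dx := d_gt0 Ox; rewrite -EFinM lee_fin /trans !indicE.
  have -> : ((x, y) \in inward Omega lam) = (x \in E).
    by apply/idP/idP; rewrite !inE.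
  have [|_] := boolP (x \in E); last by rewrite mul0r mulr0.
  rewrite inE => -[_ _ /= h _]; rewrite mul1r mulr1 /k.
  rewrite ler_wpM2l ?powR_ge0//.
  have lam20 : 0 < 2 * lam by rewrite mulr_gt0.
  have yx : d y <= 2 * lam * d x by [].
  rewrite ler_pdivlMr ?powR_gt0// mulrC ler_pdivrMr ?powR_gt0//.
  rewrite -powRM ?(ltW lam20) ?(ltW dx)//.
  apply: ge0_ler_powR => //; rewrite ?nnegrE; [exact: ltW|exact: ltW|].
  by rewrite mulr_ge0 ?ltW.
rewrite ge0_integralZl//; last first.
- by apply/measurable_EFinP; exact: measurable_indic.
rewrite integral_indic//.
apply: (@le_trans _ _ (k%:E * ((8 * d y / lam) ^+ n)%:E)%E).
  apply: lee_wpmul2l; first by rewrite lee_fin.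
  apply: le_trans (inward_to_measure_le oO lam01 y).
  apply: le_measure; rewrite ?inE//; first exact: measurableI.
rewrite -!EFinM lee_fin /k /C1 /hdy dN//.
rewrite le_eqVlt; apply/orP; left; apply/eqP.
rewrite !expr_div_n exprMn.
field; rewrite -/d !expf_neq0 ?gt_eqF ?powR_gt0//=.

Qed.

(** As [c0] and [C1] are of order lam^n and lam^(s p), the coefficient of the
    Hardy integral on the right becomes negligible for small lam. *)
Lemma hardy_absorb :
  (c0%:E * hardy_integral s p Omega u <=
   (2 `^ p)%:E * (gagliardo s p Omega u + C1%:E * hardy_integral s p Omega u))%E.
Proof.
apply: (le_trans absorb_x); apply: lee_wpmul2l; first by rewrite lee_fin powR_ge0.
exact: (leeD (lexx _) trans_bound).
Qed.

End hardy_absorption.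

(** * The inequality for functions with finite Hardy integral *)

Section finite_hardy_integral.
Context {R : realType} {n : nat}.
Context (s p : R).
Hypothesis s0 : 0 < s.
Hypothesis p0 : 0 < p.
Hypothesis spn : n%:R < s * p.
Implicit Types (Omega : set 'rV[R]_n) (u phi : 'rV[R]_n -> R).
Let leb := @lebesgue_rV R n.
Local Notation V := 'rV[R]_n.

Let alpha := s * p.
Let N : R := n%:R + s * p.

(** The left-hand side divided by the right-hand side is K * lam^(s p - n), with
    the [K] below independent of lam; lam is chosen to make this ratio 1. *)
Lemma contraction_scale : exists2 lam : R, 0 < lam <= 1 &
  2 `^ p * ((2 * lam) `^ N * (8 / lam) ^+ n) <= (lam / n.+1%:R) ^+ n / 2.
Proof.
have N0 : 0 <= N by rewrite addr_ge0// mulr_ge0// ltW.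
have e0 : 0 < alpha - n%:R by rewrite subr_gt0.
pose K : R := 2 * (2 `^ p * (2 `^ N * (8 * n.+1%:R) ^+ n)).
have K1 : 1 <= K.
  have h r : 0 <= r -> 1 <= 2 `^ r :> R.
    by move=> r0; rewrite -[leLHS](powRr0 2) ler_powR// ler1n.
  have h8 : 1 <= (8 * n.+1%:R) ^+ n :> R.
    by rewrite exprn_ege1// -natrM ler1n muln_gt0.
  have hp := h _ (ltW p0); have hN := h _ N0.
  rewrite /K -[leLHS]mulr1 ler_pM ?ler1n// -[leLHS]mulr1 ler_pM//.
  by rewrite -[leLHS]mulr1 ler_pM.
have K0 : 0 < K by apply: lt_le_trans K1.
pose lam := K `^ (- (alpha - n%:R)^-1).
have lam0 : 0 < lam by rewrite powR_gt0.
exists lam.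
  by rewrite lam0/= -[leRHS](powRr0 K) ler_powR// oppr_le0 invr_ge0 ltW.
have lamK : lam `^ (alpha - n%:R) = K^-1.
  by rewrite /lam -powRrM mulNr mulVf ?gt_eqF// powR_inv1// ltW.
rewrite le_eqVlt; apply/orP; left; apply/eqP.
have -> : N = n%:R + n%:R + (alpha - n%:R) by rewrite /N /alpha; ring.
have pD r t : (2 * lam) `^ (r + t) = (2 * lam) `^ r * (2 * lam) `^ t.
  by apply: powRD; apply/implyP => _; rewrite gt_eqF// mulr_gt0.
rewrite (pD _ (alpha - _)) (pD n%:R n%:R).
rewrite !powRM ?(ltW lam0)// lamK !powR_mulrn ?(ltW lam0)//.
have K' : K = 2 *
    (2 `^ p * (2 ^+ n * 2 ^+ n * 2 `^ (alpha - n%:R) * (8 * n.+1%:R) ^+ n)).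
  rewrite /K /N -!powR_mulrn// -!powRD ?pnatr_eq0 ?implybT//.
  by congr (2 * (_ * (2 `^ _ * _))); rewrite /alpha; ring.
rewrite K' !expr_div_n exprMn.
by field; rewrite !expf_neq0 ?gt_eqF ?powR_gt0// ?nat1r ?pnatr_eq0.
Qed.

(** With the scale of [contraction_scale], [hardy_absorb] reads
    c0 * H <= 2^p * G + c0 / 2 * H, and finiteness allows to subtract. *)
Lemma hardy_of_finite : exists2 C : R, 0 < C &
  forall Omega u, open Omega -> boundary Omega !=set0 -> measurable_fun setT u ->
  (hardy_integral s p Omega u < +oo)%E ->
  (hardy_integral s p Omega u <= C%:E * gagliardo s p Omega u)%E.
Proof.
have [lam lam01 small] := contraction_scale.
have lam0 : 0 < lam by case/andP: lam01.
pose c0 : R := (lam / n.+1%:R) ^+ n.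
have c00 : 0 < c0 by rewrite exprn_gt0// divr_gt0.
exists (2 * 2 `^ p / c0); first by rewrite divr_gt0// mulr_gt0// powR_gt0.
move=> Omega u oO b0 mu Hoo.
have := hardy_absorb oO b0 lam01 p0 s0 mu.
have : (0 <= hardy_integral s p Omega u)%E.
  by apply: integral_ge0 => x _; rewrite lee_fin divr_ge0 ?powR_ge0.
have : (0 <= gagliardo s p Omega u)%E.
  apply: integral_ge0 => x _; apply: integral_ge0 => y _.
  by rewrite lee_fin divr_ge0 ?powR_ge0.
have Cpos : 0 < 2 * 2 `^ p / c0 by rewrite divr_gt0// mulr_gt0// powR_gt0.
move: Hoo; case: (hardy_integral s p Omega u) => [h| |] // _.
case: (gagliardo s p Omega u) => [g| |] //; last first.
  by move=> _ _ _; rewrite gt0_muley ?lte_fin// leey.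
rewrite -!(EFinM, EFinD) !lee_fin => g0 h0 habs.
rewrite mulrAC ler_pdivlMr// mulrC.
have := ler_wpM2r h0 small; move: habs; rewrite -/c0 -/N.
by set C1 := _ `^ N * _; lra.
Qed.

Lemma compact_continuous_bound (f : V -> R) (K : set V) : compact K ->
  {in K, continuous f} -> exists M, forall x, K x -> `|f x| <= M.
Proof.
move=> cK cf.
have [M [_ MP]] :=
  compact_bounded (continuous_compact (continuous_in_subspaceT cf) cK).
exists (M + 1) => x Kx; apply: (MP (M + 1)); first by rewrite ltrDl.
by exists x.
Qed.

Lemma Cc_smooth_continuous Omega phi : Cc_smooth Omega phi -> continuous phi.
Proof. by move=> [sphi _ _]; have [+ _] := sphi [::]. Qed.

Lemma Cc_smooth_measurable Omega phi :
  Cc_smooth Omega phi -> measurable_fun setT phi.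
Proof. by move=> /Cc_smooth_continuous; exact: continuous_measurable_rV. Qed.

(** On the compact support both |phi| and 1 / d are bounded, and the support
    fits in a cube, which has finite measure. *)
Lemma hardy_Cc_smooth_lty Omega phi : open Omega -> boundary Omega !=set0 ->
  Cc_smooth Omega phi -> (hardy_integral s p Omega phi < +oo)%E.
Proof.
move=> oO b0 Cphi; have mphi := Cc_smooth_measurable Cphi.
have cphi := Cc_smooth_continuous Cphi; case: Cphi => _ cK KO.
set K := closure _ in cK KO.
have mO := open_measurable_rV oO.
have [M1 M1P] : exists M, forall x, K x -> `|phi x| <= M.
  by apply: compact_continuous_bound => // x _; exact: cphi.
have [M2 M2P] : exists M, forall x, K x -> `|(dist_boundary Omega x)^-1| <= M.
  apply: compact_continuous_bound => // x; rewrite inE => /KO Ox.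
  apply: (@cvgV R _ _ (nbhs_filter x)); last exact: continuous_dist_boundary.
  by rewrite gt_eqF// dist_boundary_gt0.
have [r rP] : exists r, forall x, K x -> `|x| <= r.
  have [M [_ MP]] := compact_bounded cK.
  by exists (M + 1) => x Kx; apply: (MP (M + 1)) => //; rewrite ltrDl.
pose r' := Num.max r 0.
have r'0 : 0 <= r' by rewrite le_max lexx orbT.
have KQ : K `<=` cube 0 r'.
  move=> x Kx i; rewrite in_itv/= !mxE sub0r add0r -ler_norml.
  apply: (@le_trans _ _ r); last by rewrite le_max lexx.
  apply: le_trans (rP _ Kx).
  rewrite [leRHS]mx_normrE.
  exact: (le_bigmax _ (fun ij : 'I_1 * 'I_n => `|x ij.1 ij.2|) (ord0, i)).
pose M := Num.max M1 0 `^ p * Num.max M2 0 `^ (s * p).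
have M0 : 0 <= M by rewrite mulr_ge0 ?powR_ge0.
have mQ := measurable_cube (0 : V) r'.
apply: (@le_lt_trans _ _ (\int[leb]_(x in Omega) (M%:E * (\1_(cube 0 r') x)%:E))%E).
  apply: ge0_le_integral.
  - exact: mO.
  - by move=> x _; rewrite lee_fin divr_ge0 ?powR_ge0.
  - apply: measurable_funTS; apply/measurable_EFinP.
    exact: measurable_hardy_integrand.
  - apply: measurable_funeM; apply/measurable_EFinP; exact: (measurable_indic mQ).
  move=> x Ox; rewrite -EFinM lee_fin.
  have [Kx|nKx] := pselect (K x); last first.
    have -> : phi x = 0.
      apply: contrapT => /eqP phx; apply: nKx; exact: subset_closure.
    by rewrite normr0 powR0 ?gt_eqF// mul0r mulr_ge0.
  rewrite indicE mem_set ?mulr1; last exact: KQ.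
  have dx := dist_boundary_gt0 oO b0 Ox.
  have Md : 1 <= Num.max M2 0 * dist_boundary Omega x.
    rewrite -ler_pdivrMr// mul1r le_max.
    by apply/orP; left; apply: le_trans (ler_norm _) (M2P _ Kx).
  rewrite ler_pdivrMr ?powR_gt0// /M -mulrA -powRM ?(ltW dx) ?le_max ?lexx ?orbT//.
  rewrite -[leLHS]mulr1; apply: ler_pM; rewrite ?powR_ge0//.
    apply: ge0_ler_powR; rewrite ?nnegrE ?le_max ?lexx ?orbT//; first exact: ltW.
    by rewrite (M1P _ Kx).
  have -> : 1 = 1 `^ (s * p) :> R by rewrite powR1.
  apply: ge0_ler_powR => //.
  - by rewrite mulr_ge0// ltW.
  - by rewrite nnegrE.
  - by rewrite nnegrE (le_trans _ Md).
rewrite ge0_integralZl//; last first.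
- by apply/measurable_EFinP; exact: (measurable_indic mQ).
rewrite integral_indic// lte_mul_pinfty// ?lee_fin//.
apply: (@le_lt_trans _ _ (leb (cube 0 r'))).
  by apply: le_measure; rewrite ?inE//; exact: measurableI.
by rewrite lebesgue_cube// ltry.
Qed.

End finite_hardy_integral.

(** * Density *)

Section density.
Context {R : realType} {n : nat}.
Context (s p : R).
Hypothesis s0 : 0 < s.
Hypothesis p0 : 0 < p.
Implicit Types (Omega U : set 'rV[R]_n) (u v phi : 'rV[R]_n -> R).
Let leb := @lebesgue_rV R n.
Local Notation V := 'rV[R]_n.
Local Open Scope ereal_scope.

Lemma gagliardo_ge0 U u : 0 <= gagliardo s p U u.
Proof.
apply: integral_ge0 => x _; apply: integral_ge0 => y _.
by rewrite lee_fin divr_ge0 ?powR_ge0.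
Qed.

Let powR_integral_ge0 U u : 0 <= \int[leb]_(x in U) (`|u x| `^ p)%:E.
Proof. by apply: integral_ge0 => x _; rewrite lee_fin powR_ge0. Qed.

Lemma sobolev_norm_lt U u (e : R) : (0 < e)%R ->
  sobolev_norm s p U u < (e `^ p^-1)%:E ->
  \int[leb]_(x in U) (`|u x| `^ p)%:E <= e%:E /\ gagliardo s p U u <= e%:E.
Proof.
move=> e0; rewrite /sobolev_norm -/leb.
have A0 := powR_integral_ge0 U u; have G0 := gagliardo_ge0 U u.
move: A0 G0; set A := \int[_]_(_ in _) _; set G := gagliardo _ _ _ _ => A0 G0.
rewrite ltNge => /negP h.
have AGe : A + G <= e%:E.
  rewrite leNgt; apply/negP => eAG; apply: h.
  rewrite -poweR_EFin; apply: gt0_ler_poweR.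
  - by rewrite invr_ge0 ltW.
  - by rewrite in_itv/= leey lee_fin ltW.
  - by rewrite in_itv/= leey adde_ge0.
  - exact: ltW.
by split; apply: le_trans AGe; rewrite ?leeDl ?leeDr.
Qed.

Let gint u x y : R := (`|u x - u y| `^ p / enorm (x - y) `^ (n%:R + s * p))%R.

Let gint_ge0 u x y : (0 <= gint u x y)%R.
Proof. by rewrite divr_ge0 ?powR_ge0. Qed.

Let mgint u : measurable_fun setT u ->
  measurable_fun [set: V * V] (fun z => (gint u z.1 z.2)%:E).
Proof.
by move=> mu; apply/measurable_EFinP; exact: measurable_gagliardo_integrand.
Qed.

Let mgint1 u U x : measurable_fun setT u ->
  measurable_fun U (fun y => (gint u x y)%:E).
Proof.
move=> mu; apply: measurable_funTS.
exact: (measurableT_comp (mgint mu) (measurable_pair1 x)).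
Qed.

Let minner u U W : measurable U -> measurable_fun setT u ->
  measurable_fun W (fun x => \int[leb]_(y in U) (gint u x y)%:E).
Proof.
move=> mU mu; apply: measurable_funTS.
by apply: (measurable_fun_integral_in leb (mgint mu)) => // z; exact: gint_ge0.
Qed.

Let inner_ge0 u U x : 0 <= \int[leb]_(y in U) (gint u x y)%:E.
Proof. by apply: integral_ge0 => y _; exact: gint_ge0. Qed.

Lemma gagliardo_subset U W u : measurable U -> measurable W -> U `<=` W ->
  measurable_fun setT u -> gagliardo s p U u <= gagliardo s p W u.
Proof.
move=> mU mW UW mu; rewrite /gagliardo -/leb.
apply: (@le_trans _ _ (\int[leb]_(x in U) \int[leb]_(y in W) (gint u x y)%:E)).
  apply: ge0_le_integral.
  - exact: mU.
  - by move=> x _; exact: inner_ge0.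
  - exact: minner.
  - exact: minner.
  - move=> x _; apply: ge0_subset_integral => //; first exact: mgint1.
    by move=> y _; exact: gint_ge0.
by apply: ge0_subset_integral => //; exact: minner.
Qed.

Lemma sobolev_norm_subset U W u : measurable U -> measurable W -> U `<=` W ->
  measurable_fun setT u -> sobolev_norm s p U u <= sobolev_norm s p W u.
Proof.
move=> mU mW UW mu; apply: gt0_ler_poweR.
- by rewrite invr_ge0 ltW.
- by rewrite in_itv/= leey adde_ge0// gagliardo_ge0.
- by rewrite in_itv/= leey adde_ge0// gagliardo_ge0.
apply: leeD; last exact: gagliardo_subset.
apply: ge0_subset_integral => //.
apply: measurable_funTS; apply/measurable_EFinP.
by apply: measurable_fun_powR; exact: measurable_fun_normr.
Qed.

(** A weak triangle inequality in the p-th powers; the constant 2^p is harmless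
    here and spares Minkowski's inequality. *)
Lemma gagliardo_le_near U u phi : measurable U ->
  measurable_fun setT u -> measurable_fun setT phi ->
  gagliardo s p U phi <=
  (2 `^ p)%:E * (gagliardo s p U u + gagliardo s p U (fun x => u x - phi x)%R).
Proof.
move=> mU mu mphi.
have mv : measurable_fun setT (fun x => u x - phi x)%R by exact: measurable_funB.
set v := (fun x => _) in mv *.
rewrite /gagliardo -/leb.
rewrite -(ge0_integralD leb mU (fun x _ => inner_ge0 u U x) (minner mU mu)
  (fun x _ => inner_ge0 v U x) (minner mU mv)).
rewrite -ge0_integralZl//; last first.
- by move=> x _; apply: adde_ge0; exact: inner_ge0.
- by apply: emeasurable_funD; exact: minner.
apply: ge0_le_integral.
- exact: mU.
- by move=> x _; exact: inner_ge0.
- exact: (minner mU mphi).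
- by apply: measurable_funeM; apply: emeasurable_funD; exact: minner.
move=> x _.
have g0 w y : U y -> 0 <= (gint w x y)%:E by move=> _; exact: gint_ge0.
rewrite -(ge0_integralD leb mU (g0 u) (mgint1 x mu) (g0 v) (mgint1 x mv)).
rewrite -ge0_integralZl//; last first.
- by move=> y _; apply: adde_ge0; exact: gint_ge0.
- by apply: emeasurable_funD; exact: mgint1.
apply: ge0_le_integral.
- exact: mU.
- by move=> y _; exact: gint_ge0.
- exact: (mgint1 x mphi).
- by apply: measurable_funeM; apply: emeasurable_funD; exact: mgint1.
move=> y _; rewrite -EFinD -EFinM lee_fin -mulrDl mulrA.
apply: ler_wpM2r; first by rewrite invr_ge0 powR_ge0.
have := powR_normD (u x - u y) (- (v x - v y)) (ltW p0).
by rewrite normrN (_ : u x - u y - (v x - v y) = phi x - phi y)%R // /v; ring.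
Qed.

(** On this set the Hardy weight is at most (j+1)^(s p). *)
Let away Omega (j : nat) : set V :=
  Omega `&` [set x | (j.+1%:R^-1 <= dist_boundary Omega x)%R].

Let maway Omega j : open Omega -> measurable (away Omega j).
Proof.
move=> oO; apply: measurableI; first exact: open_measurable_rV.
have mc : measurable_fun [set: V] (cst (j.+1%:R^-1 : R)%R) by exact: measurable_cst.
have := measurable_fun_le measurableT mc (measurable_dist_boundary Omega).
by rewrite setTI.
Qed.

Let hint Omega u x : R := (`|u x| `^ p / dist_boundary Omega x `^ (s * p))%R.

Let hint_ge0 Omega u x : (0 <= hint Omega u x)%R.
Proof. by rewrite divr_ge0 ?powR_ge0. Qed.

Let mhint Omega u U : measurable_fun setT u ->
  measurable_fun U (fun x => (hint Omega u x)%:E).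
Proof.
move=> mu; apply: measurable_funTS; apply/measurable_EFinP.
exact: measurable_hardy_integrand.
Qed.

Lemma hardy_away_le_near Omega j u phi : open Omega ->
  measurable_fun setT u -> measurable_fun setT phi ->
  \int[leb]_(x in away Omega j) (hint Omega u x)%:E <=
  (2 `^ p)%:E * (hardy_integral s p Omega phi +
    (j.+1%:R `^ (s * p))%:E * \int[leb]_(x in Omega) (`|u x - phi x| `^ p)%:E).
Proof.
move=> oO mu mphi; have mO := open_measurable_rV oO.
have mv : measurable_fun setT (fun x => u x - phi x)%R by exact: measurable_funB.
have mvp U : measurable_fun U (fun x => (`|u x - phi x| `^ p)%:E).
  apply: measurable_funTS; apply/measurable_EFinP.
  by apply: measurable_fun_powR; exact: measurable_fun_normr.
have mF := maway j oO.
have subF : away Omega j `<=` Omega by move=> x [].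
rewrite -ge0_integralZl//.
rewrite /hardy_integral -/leb -ge0_integralD//; last 3 first.
- by move=> x _; exact: hint_ge0.
- exact: mhint.
- exact: measurable_funeM.
have mS U : measurable_fun U (fun x => (hint Omega phi x)%:E
    + (j.+1%:R `^ (s * p))%:E * (`|u x - phi x| `^ p)%:E).
  by apply: emeasurable_funD; [exact: mhint|exact: measurable_funeM].
have S0 x : 0 <= (hint Omega phi x)%:E
    + (j.+1%:R `^ (s * p))%:E * (`|u x - phi x| `^ p)%:E.
  by apply: adde_ge0; [exact: hint_ge0|rewrite mule_ge0// lee_fin powR_ge0].
rewrite -ge0_integralZl//; last by move=> x _; exact: S0.
apply: (@le_trans _ _ (\int[leb]_(x in away Omega j) ((2 `^ p)%:E *
   ((hint Omega phi x)%:E + (j.+1%:R `^ (s * p))%:E * (`|u x - phi x| `^ p)%:E)))).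
  apply: ge0_le_integral.
  - exact: mF.
  - by move=> x _; exact: hint_ge0.
  - exact: mhint.
  - exact: measurable_funeM.
  move=> x [Ox /= jx]; rewrite -!(EFinM, EFinD) lee_fin.
  have j0 : (0 < j.+1%:R^-1 :> R)%R by rewrite invr_gt0.
  have w0 : (0 <= (dist_boundary Omega x `^ (s * p))^-1)%R.
    by rewrite invr_ge0 powR_ge0.
  have := powR_normD (phi x) (u x - phi x) (ltW p0).
  rewrite (_ : phi x + (u x - phi x) = u x)%R; last by ring.
  move=> /(ler_wpM2r w0) /le_trans; apply.
  rewrite -mulrA ler_wpM2l ?powR_ge0// mulrDl lerD2l mulrC ler_wpM2r ?powR_ge0//.
  have sp0 : (0 <= s * p)%R by rewrite mulr_ge0// ltW.
  apply: (le_trans (powR_inv_le sp0 j0 jx)).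
  by rewrite -powRN -powR_inv1// -powRrM mulrNN mul1r.
apply: ge0_subset_integral => //.
- exact: measurable_funeM.
- by move=> x _; rewrite mule_ge0// lee_fin powR_ge0.
Qed.

(** Monotone convergence: the sets away from the boundary exhaust Omega. *)
Lemma hardy_le_of_away Omega u (b : \bar R) : open Omega ->
  boundary Omega !=set0 -> measurable_fun setT u ->
  (forall j, \int[leb]_(x in away Omega j) (hint Omega u x)%:E <= b) ->
  hardy_integral s p Omega u <= b.
Proof.
move=> oO b0 mu H.
have mF j := maway j oO.
have nd : nondecreasing_seq (away Omega).
  move=> i j ij; apply/subsetPset => x [Ox /= ix]; split => //=.
  by apply: le_trans ix; rewrite lef_pV2 ?posrE// ler_nat ltnS.
have mi i : measurable_fun (away Omega i) (fun x => (hint Omega u x)%:E).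
  exact: mhint.
have i0 i x : away Omega i x -> 0 <= (hint Omega u x)%:E.
  by move=> _; exact: hint_ge0.
have := ge0_nondecreasing_set_cvg_integral (mu := leb) nd mF mi i0.
rewrite (_ : \bigcup_i away Omega i = Omega); last first.
  apply/seteqP; split => [x [j _ []]//|x Ox].
  have dx := dist_boundary_gt0 oO b0 Ox.
  have [k _ /(_ k)/(_ (leqnn k))] := near_infty_natSinv_lt (PosNum dx).
  by move=> /= kx; exists k => //; split => //=; exact: ltW.
move=> cv; rewrite /hardy_integral -/leb -/(hint _ _ _).
rewrite -(cvg_lim (@ereal_hausdorff R) cv).
by apply: lime_le; [apply/cvg_ex; eexists; exact: cv|exact: nearW].
Qed.

(** For fixed j the two errors made in replacing u by phi, in the truncated
    Hardy integral and in the seminorm, are at most multiples of the p-th power of the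
    norm of u - phi, so they disappear in the limit. *)
Lemma hardy_closure (C : R) Omega u : (0 < C)%R -> open Omega ->
  boundary Omega !=set0 -> measurable_fun setT u ->
  (forall phi, Cc_smooth Omega phi ->
    hardy_integral s p Omega phi <= C%:E * gagliardo s p Omega phi) ->
  (forall e : R, (0 < e)%R -> exists2 phi, Cc_smooth Omega phi &
    sobolev_norm s p Omega (fun x => u x - phi x)%R < e%:E) ->
  hardy_integral s p Omega u <=
  (2 `^ p * (C * 2 `^ p))%:E * gagliardo s p Omega u.
Proof.
move=> C0 oO b0 mu HC appr; have mO := open_measurable_rV oO.
have P0 : (0 < 2 `^ p :> R)%R by rewrite powR_gt0.
have K0 : (0 < 2 `^ p * (C * 2 `^ p))%R by rewrite !mulr_gt0.
have := gagliardo_ge0 Omega u.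
case Gu : (gagliardo s p Omega u) => [g| |]// g0; last first.
  by rewrite gt0_muley ?lte_fin// leey.
apply: hardy_le_of_away => // j.
apply/lee_addgt0Pr => eta eta0.
pose J : R := (j.+1%:R `^ (s * p))%R.
have J0 : (0 <= J)%R by rewrite powR_ge0.
(* The total error for an approximation with p-th power e is D * e. *)
pose D : R := (2 `^ p * (C * 2 `^ p + J))%R.
have D0 : (0 < D)%R by rewrite mulr_gt0// ltr_wpDr// mulr_gt0.
pose e : R := (eta / D)%R.
have e0 : (0 < e)%R by rewrite divr_gt0.
have [|phi Cphi] := appr (e `^ p^-1)%R; first by rewrite powR_gt0.
move=> /(sobolev_norm_lt e0)[Ae Ge].
have mphi := Cc_smooth_measurable Cphi.
apply: (le_trans (hardy_away_le_near j oO mu mphi)).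
have -> : (2 `^ p * (C * 2 `^ p))%:E * g%:E + eta%:E =
    (2 `^ p)%:E * (C%:E * ((2 `^ p)%:E * (g%:E + e%:E)) + J%:E * e%:E).
  rewrite -!(EFinM, EFinD); congr EFin.
  have -> : eta = (D * e)%R by rewrite /e mulrC divfK ?gt_eqF.
  rewrite /D; ring.
apply: lee_wpmul2l; first by rewrite lee_fin ltW.
apply: leeD; last by apply: lee_wpmul2l; rewrite ?lee_fin.
apply: (le_trans (HC _ Cphi)); apply: lee_wpmul2l; first by rewrite lee_fin ltW.
apply: (le_trans (gagliardo_le_near mO mu mphi)).
apply: lee_wpmul2l; first by rewrite lee_fin ltW.
by rewrite Gu; exact: leeD.
Qed.

End density.

(** * The Hardy inequalities *)

Lemma regional_hardy (R : realType) (n : nat) (s p : R) :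
  0 < s -> 0 < p -> n%:R < s * p ->
  exists2 C : R, 0 < C & forall Omega : set 'rV[R]_n, open Omega -> Omega <> setT ->
  forall u, W0 s p Omega u ->
    (hardy_integral s p Omega u <= C%:E * gagliardo s p Omega u)%E.
Proof.
move=> s0 p0 spn; have [C C0 HC] := @hardy_of_finite R n s p s0 p0 spn.
have P0 : 0 < 2 `^ p :> R by rewrite powR_gt0.
exists (2 `^ p * (C * 2 `^ p)); first by rewrite !mulr_gt0.
move=> Omega oO OT u [mu appr].
have [[x Ox]|Oe] := pselect (Omega !=set0); last first.
  have -> : Omega = set0 by apply/seteqP; split => // x Ox; case: Oe; exists x.
  by rewrite /hardy_integral /gagliardo !integral_set0 mule0.
have b0 := boundary_neq0 oO OT Ox; have mO := open_measurable_rV oO.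
(* The values of u outside Omega are arbitrary and need not be measurable. *)
pose u' := u \_ Omega.
have u'E y : Omega y -> u' y = u y by move=> Oy; rewrite /u' patchE mem_set.
have mu' : measurable_fun setT u' := iffLR (measurable_restrictT u mO) mu.
have HE : hardy_integral s p Omega u = hardy_integral s p Omega u'.
  by apply: eq_integral => y; rewrite inE => /u'E ->.
have GE (phi : 'rV[R]_n -> R) : gagliardo s p Omega (fun x => u x - phi x) =
    gagliardo s p Omega (fun x => u' x - phi x).
  apply: eq_integral => y; rewrite inE => /u'E ->.
  by apply: eq_integral => z; rewrite inE => /u'E ->.
have LE (phi : 'rV[R]_n -> R) :
    (\int[lebesgue_rV n]_(y in Omega) (`|u y - phi y| `^ p)%:E =
     \int[lebesgue_rV n]_(y in Omega) (`|u' y - phi y| `^ p)%:E)%E.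
  by apply: eq_integral => y; rewrite inE => /u'E ->.
have GuE : gagliardo s p Omega u = gagliardo s p Omega u'.
  apply: eq_integral => y; rewrite inE => /u'E ->.
  by apply: eq_integral => z; rewrite inE => /u'E ->.
rewrite HE GuE; apply: (hardy_closure s0 p0 C0 oO b0 mu').
- move=> phi Cphi; apply: (HC Omega phi oO b0 (Cc_smooth_measurable Cphi)).
  exact: (hardy_Cc_smooth_lty s0 p0 oO b0 Cphi).
- move=> e e0; have [phi Cphi small] := appr e e0; exists phi; first exact: Cphi.
  have <- : sobolev_norm s p Omega (fun x => u x - phi x) =
      sobolev_norm s p Omega (fun x => u' x - phi x); last exact: small.
  by rewrite /sobolev_norm GE LE.
Qed.

Unset Implicit Arguments.

Theorem theorem1p10 (R : realType) (n : nat) (s p : R)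
    (s_gt0 : 0 < s) (s_lt1 : s < 1) (p_gt1 : 1 < p) (sp_gtn : n%:R < s * p) :
  (exists C : R, 0 < C /\
    forall Omega : set 'rV[R]_n, open Omega -> Omega <> setT ->
    forall u, WOmega s p Omega u ->
      (hardy_integral s p Omega u <= C%:E * gagliardo s p setT u)%E) /\
  (exists C : R, 0 < C /\
    forall Omega : set 'rV[R]_n, open Omega -> Omega <> setT ->
    forall u, W0 s p Omega u ->
      (hardy_integral s p Omega u <= C%:E * gagliardo s p Omega u)%E).
Proof.
have p0 : 0 < p by rewrite (lt_trans _ p_gt1).
have [C C0 HC] := @regional_hardy R n s p s_gt0 p0 sp_gtn.
split; exists C; split; [exact: C0| |exact: C0|exact: HC].
move=> Omega oO OT u [mu appr].
have mO := open_measurable_rV oO.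
apply: (@le_trans _ _ (C%:E * gagliardo s p Omega u)%E); last first.
  by apply: lee_wpmul2l; [rewrite lee_fin ltW|exact: gagliardo_subset].
apply: (HC Omega oO OT); split; first exact: (measurable_funTS mu).
move=> e e0; have [phi Cphi small] := appr e e0; exists phi; first exact: Cphi.
apply: le_lt_trans small; apply: sobolev_norm_subset => //.
by apply: measurable_funB => //; exact: (Cc_smooth_measurable Cphi).
Qed.
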